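(* Let $(G,B,w)$ be a finite weighted graph with boundary $B$ and interior $\Omega=V(G)\setminus B$, and let $k\ge 0$. Then for any given boundary data $\varphi\in A^k(\partial\Omega)$, each of the following three boundary value problems has a solution $\omega\in A^k(G)$: $$\text{(i)}\ \begin{cases}\delta d\omega=0&\text{in }\Omega\\ \omega=\varphi&\text{on }C_{k+1}(\partial\Omega),\end{cases}\qquad \text{(ii)}\ \begin{cases}d\delta\omega=0&\text{in }\Omega\\ \omega=\varphi&\text{on }C_{k+1}(\partial\Omega),\end{cases}\qquad \text{(iii)}\ \begin{cases}\Delta\omega=0&\text{in }\Omega\\ \omega=\varphi&\text{on }C_{k+1}(\partial\Omega).\end{cases}$$
   Context: All graphs are simple. $V(G),E(G)$ are the vertex and edge sets. A $k$-clique of $G$ is a set of $k$ distinct pairwise adjacent vertices; $C_k(G)$ is the set of $k$-cliques. A $k$-form on $G$ ($k\ge 0$) is a function $f:V(G)^{k+1}\to\mathbb{R}$ that is skew-symmetric in its variables and satisfies $f(v_0,\dots,v_k)=0$ whenever $\{v_0,\dots,v_k\}\notin C_{k+1}(G)$; $A^k(G)$ is the space of $k$-forms. The exterior differential $d:A^k(G)\to A^{k+1}(G)$ is $d\alpha(v_0,\dots,v_{k+1})=\sum_{j=0}^{k+1}(-1)^j\alpha(v_0,\dots,\hat v_j,\dots,v_{k+1})$ if $\{v_0,\dots,v_{k+1}\}\in C_{k+2}(G)$, and $0$ otherwise. A weight $w$ on $G$ assigns, for every $k\ge0$, to each $(v_0,\dots,v_k)\in V(G)^{k+1}$ a real number $w(v_0,\dots,v_k)$,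 symmetric in the variables, positive if $\{v_0,\dots,v_k\}\in C_{k+1}(G)$ and $0$ otherwise. For finite $G$, $\langle\alpha,\beta\rangle_G=\frac1{(k+1)!}\sum_{v_0,\dots,v_k\in V(G)}\alpha(v_0,\dots,v_k)\beta(v_0,\dots,v_k)w(v_0,\dots,v_k)$ is the inner product on $A^k(G)$, $\delta:A^{k+1}(G)\to A^k(G)$ is the adjoint of $d$ (with $\delta=0$ on $A^0(G)$), and $\Delta=d\delta+\delta d$. A graph with boundary $(G,B)$ is a simple graph $G$ with $B\subset V(G)$ such that no two vertices of $B$ are adjacent and every vertex of $B$ is adjacent to some vertex of $\Omega:=V(G)\setminus B$ (the interior). $C_{k+1}(\partial\Omega)$ is the set of $(k+1)$-cliques of $G$ with exactly one vertex in $B$ and the remaining $k$ vertices in $\Omega$. $A^k(\partial\Omega)$ is the space of functions $f:B\times\Omega^k\to\mathbb{R}$, skew-symmetric in the last $k$ variables, with $f(v_0,\dots,v_k)=0$ when $\{v_0,\dots,v_k\}\notin C_{k+1}(\partial\Omega)$. For a form $\theta\in A^k(G)$, ''$\theta=0$ in $\Omega$'' means that $\theta$ vanishes on every $(k+1)$-clique of $G$ contained in $\Omega$; ''$\omega=\varphi$ on $C_{k+1}(\partial\Omega)$'' means that the restriction of $\omega$ to $B\times\Omega^k$ equals $\varphi$. *)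

(* Defs.v *)
From HB Require Import structures.
From mathcomp Require Import all_boot all_order all_algebra all_fingroup.
From mathcomp Require Import boolp classical_sets reals.

Set Implicit Arguments.
Unset Strict Implicit.
Unset Printing Implicit Defensive.

Import Order.TTheory GRing.Theory Num.Theory.
Local Open Scope ring_scope.

Record graph (T : finType) := Graph {
  adj :> rel T;
  adj_sym : symmetric adj;
  adj_irr : irreflexive adj
}.

Definition cliques (T : finType) (G : graph T) (n : nat) : {set {set T}} :=
  [set S : {set T} | (#|S| == n) &&
     [forall x in S, forall y in S, (x != y) ==> G x y]].

Record boundary (T : finType) (G : graph T) := Boundary {
  bset :> {set T};
  bset_indep : forall x y, x \in bset -> y \in bset -> ~~ G x y;
  bset_adj : forall x, x \in bset -> exists2 y, y \notin bset & G x y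
}.

(* [bcliques B k] is C_{k+1}(dOmega), whose members have k + 1 vertices. *)
Definition bcliques (T : finType) (G : graph T) (B : boundary G) (k : nat) :
    {set {set T}} :=
  [set S in cliques G k.+1 | (#|S :&: B| == 1%N) && (#|S :\: B| == k)].

Definition vtuple (T : finType) (n : nat) := {ffun 'I_n -> T}.

Definition vset (T : finType) (n : nat) (v : vtuple T n) : {set T} :=
  [set v i | i : 'I_n].

Definition vperm (T : finType) (n : nat) (s : 'S_n) (v : vtuple T n) :
    vtuple T n := [ffun i => v (s i)].

Definition vdrop (T : finType) (n : nat) (j : 'I_n.+1) (v : vtuple T n.+1) :
    vtuple T n := [ffun i => v (lift j i)].

Definition vcons (T : finType) (n : nat) (x : T) (v : vtuple T n) :
    vtuple T n.+1 := [ffun i => if unlift ord0 i is Some j then v j else x].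

Definition cochain (R : realType) (T : finType) (k : nat) :=
  {ffun vtuple T k.+1 -> R}.

Definition is_form (R : realType) (T : finType) (G : graph T) (k : nat)
    (f : cochain R T k) : Prop :=
  (forall (s : 'S_k.+1) v, f (vperm s v) = (-1) ^+ s * f v) /\
  (forall v, vset v \notin cliques G k.+1 -> f v = 0).

Definition dext (R : realType) (T : finType) (G : graph T) (k : nat)
    (f : cochain R T k) : cochain R T k.+1 :=
  [ffun v => if vset v \in cliques G k.+2
             then \sum_(j < k.+2) (-1) ^+ j * f (vdrop j v) else 0].

Record weight (R : realType) (T : finType) (G : graph T) := Weight {
  wgt :> forall k : nat, vtuple T k.+1 -> R;
  wgt_sym : forall k (s : 'S_k.+1) (v : vtuple T k.+1),
    wgt (vperm s v) = wgt v;
  wgt_gt0 : forall k (v : vtuple T k.+1),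
    vset v \in cliques G k.+1 -> 0 < wgt v;
  wgt_eq0 : forall k (v : vtuple T k.+1),
    vset v \notin cliques G k.+1 -> wgt v = 0
}.

Definition inner (R : realType) (T : finType) (G : graph T) (w : weight R G)
    (k : nat) (f g : cochain R T k) : R :=
  (k.+1)`!%:R^-1 * \sum_(v : vtuple T k.+1) f v * g v * w k v.

Definition adjoint_value (R : realType) (T : finType) (G : graph T)
    (w : weight R G) (k : nat) (b : cochain R T k.+1) (g : cochain R T k) :
    Prop :=
  is_form G g /\
  forall a : cochain R T k, is_form G a ->
    inner w (dext G a) b = inner w a g.

(* The adjoint of [dext]: the value at a form [b] is the unique form [g] such
   that [adjoint_value w b g]; see [codiffP] and [adjoint_value_uniq]. *)
Definition codiff (R : realType) (T : finType) (G : graph T) (w : weight R G)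
    (k : nat) (b : cochain R T k.+1) : cochain R T k :=
  xget 0 [set g | adjoint_value w b g]%classic.

(* The codifferential vanishes on 0-forms. *)
Definition d_codiff (R : realType) (T : finType) (G : graph T) (w : weight R G)
    (k : nat) : cochain R T k -> cochain R T k :=
  match k with
  | 0 => fun _ => 0
  | _.+1 => fun f => dext G (codiff w f)
  end.

Definition codiff_d (R : realType) (T : finType) (G : graph T) (w : weight R G)
    (k : nat) (f : cochain R T k) : cochain R T k := codiff w (dext G f).

Definition laplacian (R : realType) (T : finType) (G : graph T)
    (w : weight R G) (k : nat) (f : cochain R T k) : cochain R T k :=
  d_codiff w f + codiff_d w f.

Definition bvert (T : finType) (G : graph T) (B : boundary G) :=
  {x : T | x \in (B : {set T})}.

Definition ivert (T : finType) (G : graph T) (B : boundary G) :=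
  {x : T | x \notin (B : {set T})}.

Definition bcochain (R : realType) (T : finType) (G : graph T)
    (B : boundary G) (k : nat) :=
  {ffun bvert B * vtuple (ivert B) k -> R}.

Definition bjoin (T : finType) (G : graph T) (B : boundary G) (k : nat)
    (p : bvert B * vtuple (ivert B) k) : vtuple T k.+1 :=
  vcons (val p.1) [ffun i => val (p.2 i)].

Definition is_bform (R : realType) (T : finType) (G : graph T)
    (B : boundary G) (k : nat) (f : bcochain R B k) : Prop :=
  (forall (s : 'S_k) b v, f (b, vperm s v) = (-1) ^+ s * f (b, v)) /\
  (forall p, vset (bjoin p) \notin bcliques B k -> f p = 0).

Definition restrict (R : realType) (T : finType) (G : graph T)
    (B : boundary G) (k : nat) (f : cochain R T k) : bcochain R B k :=
  [ffun p => f (bjoin p)].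

Definition zero_in_interior (R : realType) (T : finType) (G : graph T)
    (B : boundary G) (k : nat) (f : cochain R T k) : Prop :=
  forall v : vtuple T k.+1, vset v \in cliques G k.+1 ->
    vset v \subset ~: (B : {set T}) -> f v = 0.

Section WellDefined.
Variables (R : realType) (T : finType) (G : graph T) (w : weight R G).

Lemma vset_perm n (s : 'S_n) (v : vtuple T n) : vset (vperm s v) = vset v.
Proof.
apply/setP=> x; apply/imsetP/imsetP=> -[i _ ->].
  by exists (s i) => //; rewrite ffunE.
by exists ((s^-1)%g i) => //; rewrite ffunE permKV.
Qed.

Lemma vpermK n (s : 'S_n) : cancel (@vperm T n s) (vperm s^-1%g).
Proof. by move=> v; apply/ffunP=> i; rewrite !ffunE permKV. Qed.

Lemma vpermVK n (s : 'S_n) : cancel (@vperm T n s^-1%g) (vperm s).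
Proof. by move=> v; apply/ffunP=> i; rewrite !ffunE permK. Qed.

Lemma ord_perm_lift n (s : 'S_n.+1) (j : 'I_n.+1) :
  exists2 t : 'S_n, s = lift_perm j (s j) t & (s = odd j (+) odd (s j) (+) t :> bool).
Proof.
pose f i := odflt i (unlift (s j) (s (lift j i))).
have fE i : lift (s j) (f i) = s (lift j i).
  rewrite /f; case: unliftP => [u ->//|/perm_inj/eqP].
  by rewrite eq_sym (negPf (neq_lift _ _)).
have f_inj : injective f.
  by move=> a b fab; apply: (@lift_inj _ j); apply: (@perm_inj _ s); rewrite -!fE fab.
have sE : s = lift_perm j (s j) (perm f_inj).
  apply/permP=> i; case: (unliftP j i) => [u ->|->].
    by rewrite lift_perm_lift permE fE.
  by rewrite lift_perm_id.
exists (perm f_inj) => //.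
by rewrite {1}sE odd_lift_perm.
Qed.

Lemma dext_form k (f : cochain R T k) : is_form G f -> is_form G (dext G f).
Proof.
move=> [fskew f0]; split=> [s v|v vG]; last by rewrite ffunE (negPf vG).
rewrite !ffunE vset_perm; case: ifP => _; last by rewrite mulr0.
rewrite big_distrr /= [RHS](reindex_inj (@perm_inj _ s)) /=.
apply: eq_bigr => j _.
have [t sE sgn] := ord_perm_lift s j.
have -> : vdrop j (vperm s v) = vperm t (vdrop (s j) v).
  by apply/ffunP=> i; rewrite !ffunE {1}sE lift_perm_lift.
rewrite fskew !mulrA -(signr_odd _ j) -(signr_odd _ (s j)) -!signr_addb.
by rewrite sgn addbAC addbK.
Qed.

Definition codiff_formula k (b : cochain R T k.+1) : cochain R T k :=
  [ffun v => (w k v)^-1 * \sum_(x : T) b (vcons x v) * w k.+1 (vcons x v)].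

Lemma codiff_formula_form k (b : cochain R T k.+1) :
  is_form G b -> is_form G (codiff_formula b).
Proof.
move=> [bskew _]; split=> [s v|v vG]; rewrite !ffunE; last first.
  by rewrite wgt_eq0 // invr0 mul0r.
rewrite wgt_sym mulrCA; congr (_ * _); rewrite big_distrr /=.
apply: eq_bigr => x _.
have -> : vcons x (vperm s v) = vperm (lift_perm ord0 ord0 s) (vcons x v).
  apply/ffunP=> i; rewrite !ffunE; case: (unliftP ord0 i) => [u ->|->].
    by rewrite lift_perm_lift liftK ffunE.
  by rewrite lift_perm_id unlift_none.
by rewrite wgt_sym bskew odd_lift_perm /= mulrA.
Qed.

Lemma codiff_formula_adjoint k (b : cochain R T k.+1) :
  is_form G b -> adjoint_value w b (codiff_formula b).
Proof.
move=> bF; split; first exact: codiff_formula_form.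
move=> a [askew a0]; case: (bF) => bskew b0; rewrite /inner.
pose S := \sum_(v : vtuple T k.+2) a (vdrop ord0 v) * b v * w k.+1 v.
have -> : \sum_v dext G a v * b v * w k.+1 v = k.+2%:R * S.
  transitivity (\sum_(j < k.+2) \sum_(v : vtuple T k.+2)
      (-1) ^+ j * a (vdrop j v) * b v * w k.+1 v).
    rewrite exchange_big /=; apply: eq_bigr => v _; rewrite ffunE.
    case: ifP => [_|/negbT vG]; first by rewrite !big_distrl.
    by rewrite mul0r mul0r big1 // => j _; rewrite b0 // mulr0 mul0r.
  rewrite (eq_bigr (fun=> S)); last first.
    move=> j _; pose s := lift_perm j ord0 (1%g : 'S_k.+1).
    rewrite (reindex_inj (can_inj (vpermK s))) /=; apply: eq_bigr => v _.
    have -> : vdrop j (vperm s v) = vdrop ord0 v.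
      by apply/ffunP=> i; rewrite !ffunE lift_perm_lift perm1.
    rewrite bskew wgt_sym odd_lift_perm odd_perm1 /= !addbF signr_odd.
    by rewrite mulrACA -exprD addnn -signr_odd odd_double mul1r.
  by rewrite sumr_const card_ord mulr_natl.
have -> : S = \sum_(v : vtuple T k.+1) a v * codiff_formula b v * w k v.
  transitivity (\sum_(p : T * vtuple T k.+1)
      a p.2 * b (vcons p.1 p.2) * w k.+1 (vcons p.1 p.2)).
    rewrite /S (reindex (fun p : T * vtuple T k.+1 => vcons p.1 p.2)) /=.
      apply: eq_bigr => -[x v] _ /=; congr (a _ * _ * _).
      by apply/ffunP=> i; rewrite !ffunE liftK.
    exists (fun v : vtuple T k.+2 => (v ord0, vdrop ord0 v)) => [[x v] _|v _] /=.
      congr (_, _); first by rewrite ffunE unlift_none.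
      by apply/ffunP=> i; rewrite !ffunE liftK.
    apply/ffunP=> i; rewrite !ffunE.
    by case: (unliftP ord0 i) => [u ->|->] //; rewrite ffunE.
  rewrite -(pair_bigA _ (fun x v =>
    a v * b (vcons x v) * w k.+1 (vcons x v))) exchange_big /=.
  apply: eq_bigr => v _; rewrite ffunE.
  case: (boolP (vset v \in cliques G k.+1)) => vG; last first.
    by rewrite a0 // !mul0r big1 // => x _; rewrite !mul0r.
  rewrite -[RHS]mulrA [_^-1 * _ * _]mulrAC mulVf ?gt_eqF ?wgt_gt0 //.
  rewrite mul1r big_distrr /=.
  by apply: eq_bigr => x _; rewrite mulrA.
rewrite mulrA; congr (_ * _).
by rewrite factS natrM invfM mulrAC mulVf ?mul1r // pnatr_eq0.
Qed.

Lemma adjoint_value_uniq k (b : cochain R T k.+1) (g h : cochain R T k) :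
  adjoint_value w b g -> adjoint_value w b h -> g = h.
Proof.
move=> [[gskew g0] gA] [[hskew h0] hA].
pose u : cochain R T k := g - h.
have uE v : u v = g v - h v by rewrite !ffunE.
have uF : is_form G u.
  split=> [s v|v vG]; first by rewrite !uE gskew hskew mulrBr.
  by rewrite uE g0 // h0 // subr0.
have wge0 v : 0 <= w k v.
  have [vG|vG] := boolP (vset v \in cliques G k.+1); first exact/ltW/wgt_gt0.
  by rewrite wgt_eq0.
have : \sum_v u v * u v * w k v = 0.
  have : inner w u g = inner w u h by rewrite -gA // -hA.
  move/mulfI => /(_ _)/eqP; rewrite invr_eq0 pnatr_eq0 -lt0n fact_gt0.
  move=> /(_ isT); rewrite -subr_eq0 -sumrB => /eqP sum0; rewrite -[RHS]sum0.
  by apply: eq_bigr => v _; rewrite -mulrBl -mulrBr -uE.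
move/eqP; rewrite psumr_eq0 => [/allP u0|v _]; last first.
  by rewrite mulr_ge0 // -expr2 sqr_ge0.
apply/ffunP=> v; apply/eqP; rewrite -subr_eq0 -uE.
have [vG|vG] := boolP (vset v \in cliques G k.+1); last by case: uF => _ ->.
have := u0 v (mem_index_enum v); rewrite /= !mulf_eq0 orbb.
by rewrite (gt_eqF (wgt_gt0 w vG)) orbF.
Qed.

Lemma codiffP k (b : cochain R T k.+1) :
  is_form G b -> adjoint_value w b (codiff w b).
Proof.
move=> bF; rewrite /codiff.
exact: (@xgetPex _ 0 [set g | adjoint_value w b g]%classic
  (ex_intro _ _ (codiff_formula_adjoint bF))).
Qed.

End WellDefined.

(* Main.v *)
(* Each problem is the Euler-Lagrange equation of a Dirichlet energy
   (|d omega|^2, |delta omega|^2, or their sum) over the affine space of forms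
   with boundary data phi. The energy is a positive semidefinite quadratic form
   on a finite-dimensional space, so a critical point exists: a direction of
   zero energy lies in the radical by Cauchy-Schwarz. Testing criticality
   against the skew-symmetrized delta at an interior clique, which is an
   admissible variation, gives the equation at that clique. *)

Require Import Defs.
From mathcomp Require Import all_boot all_order all_algebra all_fingroup.
From mathcomp Require Import reals.
Local Open Scope ring_scope.

Set Implicit Arguments.
Unset Strict Implicit.
Unset Printing Implicit Defensive.

Import Order.TTheory GRing.Theory Num.Theory.

(** * Semidefinite bilinear forms and orthogonal projection *)

Record psd_form (R : realFieldType) (V : lmodType R) (Q : V -> V -> R) :
    Prop := PsdForm {
  psd_linear : forall c x y z, Q (c *: x + y) z = c * Q x z + Q y z;
  psd_sym : forall x y, Q x y = Q y x;
  psd_ge0 : forall x, 0 <= Q x x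
}.

Section PsdForm.
Variables (R : realFieldType) (V : vectType R) (Q : V -> V -> R).
Hypothesis Qpsd : psd_form Q.
Let Qlin := psd_linear Qpsd.
Let Qsym := psd_sym Qpsd.

Lemma psd_linearr c x y z : Q z (c *: x + y) = c * Q z x + Q z y.
Proof. by rewrite Qsym Qlin !(Qsym z). Qed.

Lemma psd0r z : Q z 0 = 0.
Proof. by have := psd_linearr (-1) 0 0 z; rewrite scaler0 addr0 mulN1r addNr. Qed.

(** Since [Q x x = 0], the value of [Q] on the diagonal at [t *: x + z] is affine in [t] with slope
    [2 * Q z x]; nonnegativity for all [t] forces the slope to vanish. *)
Lemma psd_null x z : Q x x = 0 -> Q z x = 0.
Proof.
move=> Qx; have [//|zx] := eqVneq (Q z x) 0.
(* This coefficient is chosen to make the diagonal value exactly -1. *)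
have := psd_ge0 Qpsd ((- (Q z z + 1) / Q z x / 2) *: x + z).
rewrite psd_linearr !Qlin Qx mulr0 add0r (Qsym x z).
set t := _ / 2; suff -> : t * Q z x = - (Q z z + 1) / 2.
  move=> h; exfalso; move: h.
  rewrite leNgt => /negP; apply; rewrite addrA -splitr.
  by rewrite opprD addrAC addNr add0r ltrN10.
by rewrite /t mulrAC divfK.
Qed.

Lemma psd_orth_span (us : seq V) z :
  {in us, forall u, Q z u = 0} -> {in <<us>>%VS, forall u, Q z u = 0}.
Proof.
elim: us => [|u us IH] orth x; first by rewrite span_nil memv0 => /eqP ->; rewrite psd0r.
rewrite span_cons => /memv_addP [_ /vlineP [c ->]] [y yus ->].
rewrite psd_linearr orth ?mem_head // mulr0 add0r IH // => i iu.
by rewrite orth // inE iu orbT.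
Qed.

(* Gram-Schmidt: a basis vector that becomes isotropic pairs to 0 with
   everything, so it imposes no condition. *)
Lemma psd_projection (us : seq V) x :
  exists2 a, a \in <<us>>%VS & {in <<us>>%VS, forall u, Q (x + a) u = 0}.
Proof.
elim: us x => [|u us IH] x.
  exists 0 => [|u]; first exact: mem0v.
  by rewrite span_nil memv0 => /eqP ->; rewrite psd0r.
have [a aU aP] := IH x; have [g gU gP] := IH u.
have sub y : y \in <<us>>%VS -> y \in <<u :: us>>%VS.
  by rewrite span_cons; apply/subvP/addvSr.
have u'U : u + g \in <<u :: us>>%VS by apply: rpredD (memv_span (mem_head _ _)) (sub _ gU).
(* [u + g] is the part of [u] orthogonal to [<<us>>], so subtracting a multiple of it keeps the
   orthogonality already achieved by [a]. *)
exists ((- Q (x + a) (u + g) / Q (u + g) (u + g)) *: (u + g) + a).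
  by apply: rpredD (sub _ aU); apply: rpredZ.
rewrite addrCA; apply: psd_orth_span.
set c := _ / _ => y; rewrite inE => /orP [/eqP ->|yU]; last first.
  by rewrite Qlin aP ?gP ?memv_span // mulr0 addr0.
have orth z : z \in <<us>>%VS -> Q (c *: (u + g) + (x + a)) z = 0.
  by move=> zU; rewrite Qlin aP ?gP // mulr0 addr0.
have uE : u = (-1) *: g + (u + g) by rewrite scaleN1r addrCA addNr addr0.
rewrite [X in Q _ X]uE psd_linearr orth // mulr0 add0r Qlin /c.
have [u0|u0] := eqVneq (Q (u + g) (u + g)) 0; last first.
  by rewrite divfK // addNr.
by rewrite u0 mulr0 add0r psd_null.
Qed.

End PsdForm.

Lemma psd_formD (R : realFieldType) (V : lmodType R) (P Q : V -> V -> R) :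
  psd_form P -> psd_form Q -> psd_form (fun x y => P x y + Q x y).
Proof.
move=> [Pl Ps P0] [Ql Qs Q0]; split=> [c x y z|x y|x].
- by rewrite Pl Ql mulrDr addrACA.
- by rewrite Ps Qs.
- by rewrite addr_ge0.
Qed.

(** * Linearity of the operators and their energies *)

Section Forms.
Variables (R : realType) (T : finType) (G : graph T) (B : boundary G).
Variable (w : weight R G).

(* [R^o] gives cochains their vector space structure. *)
Notation space k := {ffun vtuple T k.+1 -> R^o}.

Lemma scale_addE k (c : R) (f g : space k) v : (c *: f + g) v = c * f v + g v.
Proof. by rewrite !ffunE. Qed.

Lemma inner_psd k : psd_form (fun f g : space k => inner w f g).
Proof.
split=> [c f g h|f g|f]; rewrite /inner.
- rewrite mulrCA -mulrDr; congr (_ * _).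
  rewrite mulr_sumr -big_split /=; apply: eq_bigr => v _.
  by rewrite scale_addE !mulrDl !mulrA.
- by congr (_ * _); apply: eq_bigr => v _; rewrite (mulrC (f v)).
rewrite mulr_ge0 ?invr_ge0 ?ler0n // sumr_ge0 // => v _.
rewrite mulr_ge0 // -?expr2 ?sqr_ge0 //.
have [vG|vG] := boolP (vset v \in cliques G k.+1); first exact/ltW/wgt_gt0.
by rewrite wgt_eq0.
Qed.

Lemma inner_sym k (f g : cochain R T k) : inner w f g = inner w g f.
Proof. exact: psd_sym (inner_psd k) f g. Qed.

(** Supplies the Dirichlet energies, with [L] the differential or the codifferential formula. *)
Lemma psd_form_comp k l (L : space k -> space l) :
  (forall c f g, L (c *: f + g) = c *: L f + L g) ->
  psd_form (fun f g => inner w (L f) (L g)).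
Proof.
move=> Llin; have [il isym i0] := inner_psd l.
by split=> [c f g h|f g|f]; rewrite ?Llin.
Qed.

Lemma dext_linear k (c : R) (f g : space k) :
  dext G (c *: f + g) = c *: (dext G f : space k.+1) + dext G g.
Proof.
apply/ffunP => v; rewrite scale_addE !ffunE; case: ifP => _; last by rewrite mulr0 addr0.
rewrite mulr_sumr -big_split /=; apply: eq_bigr => j _.
by rewrite scale_addE mulrDr mulrCA.
Qed.

(* [codiff] itself is only controlled on forms, whereas the energies must be
   bilinear on all cochains; hence the explicit formula. *)
Lemma codiff_formula_linear k (c : R) (f g : space k.+1) :
  codiff_formula w (c *: f + g) =
  c *: (codiff_formula w f : space k) + codiff_formula w g.
Proof.
apply/ffunP => v; rewrite scale_addE !ffunE mulrCA -mulrDr; congr (_ * _).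
rewrite mulr_sumr -big_split /=; apply: eq_bigr => j _.
by rewrite scale_addE mulrDl mulrA.
Qed.

Lemma codiffE k (b : cochain R T k.+1) :
  is_form G b -> codiff w b = codiff_formula w b.
Proof.
move=> bF; exact: adjoint_value_uniq (codiffP w bF) (codiff_formula_adjoint w bF).
Qed.

(** * Skew-symmetrized deltas as test forms *)

Definition skew_delta k (v : vtuple T k.+1) : cochain R T k :=
  [ffun x => \sum_(s : 'S_k.+1) (-1) ^+ s * (x == vperm s v)%:R].

Lemma vpermM n (s t : 'S_n) (v : vtuple T n) :
  vperm s (vperm t v) = vperm (s * t)%g v.
Proof. by apply/ffunP => i; rewrite !ffunE permM. Qed.

Lemma skew_delta_eq0 k (v x : vtuple T k.+1) :
  vset x != vset v -> skew_delta v x = 0.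
Proof.
move=> xv; rewrite ffunE big1 // => s _; case: eqP => [xE|]; last by rewrite mulr0.
by rewrite xE vset_perm eqxx in xv.
Qed.

Lemma skew_delta_form k (v : vtuple T k.+1) :
  vset v \in cliques G k.+1 -> is_form G (skew_delta v).
Proof.
move=> vG; split=> [t x|x xG]; last first.
  by apply: skew_delta_eq0; apply: contraNneq xG => ->.
rewrite !ffunE (reindex_inj (mulgI t)) mulr_sumr; apply: eq_bigr => s _ /=.
by rewrite odd_permM signr_addb -mulrA -vpermM (can_eq (vpermK t)).
Qed.

(** The sign from [g] cancels the sign in the delta, so every permutation contributes [g v * w k v];
    their number cancels the factorial in [inner]. *)
Lemma inner_skew_delta k (v : vtuple T k.+1) (g : cochain R T k) :
  is_form G g -> inner w g (skew_delta v) = g v * w k v.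
Proof.
move=> [gskew _]; rewrite /inner.
transitivity ((k.+1)`!%:R^-1 * \sum_(s : 'S_k.+1) g v * w k v).
  congr (_ * _); transitivity (\sum_(s : 'S_k.+1) \sum_x
      g x * ((-1) ^+ s * (x == vperm s v)%:R) * w k x).
    rewrite exchange_big /=; apply: eq_bigr => x _.
    by rewrite ffunE mulr_sumr mulr_suml.
  apply: eq_bigr => s _; rewrite (bigD1 (vperm s v)) //= big1 ?addr0 => [|x /negPf ->].
    by rewrite eqxx mulr1 gskew wgt_sym (mulrAC _ (g v)) -expr2 sqrr_sign mul1r.
  by rewrite !mulr0 mul0r.
rewrite sumr_const card_Sn -[X in _ * X]mulr_natl mulKf //.
by rewrite pnatr_eq0 -lt0n fact_gt0.
Qed.

Lemma is_form_linear k c (f g : space k) :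
  is_form G f -> is_form G g -> is_form G (c *: f + g : cochain R T k).
Proof.
move=> [fs f0] [gs g0]; split=> [s v|v vG]; rewrite !scale_addE.
  by rewrite fs gs mulrDr mulrCA.
by rewrite f0 // g0 // mulr0 addr0.
Qed.

(** * Extension of boundary data to a form *)

Lemma bjoin_inj k : injective (@bjoin T G B k).
Proof.
move=> [b v] [b' v'] /ffunP e; congr (_, _).
  by apply: val_inj; have := e ord0; rewrite !ffunE unlift_none.
apply/ffunP => i; apply: val_inj.
by have := e (lift ord0 i); rewrite !ffunE liftK !ffunE.
Qed.

Lemma vset_bjoin k (p : bvert B * vtuple (ivert B) k) : val p.1 \in vset (bjoin p).
Proof. by apply/imsetP; exists ord0; rewrite // ffunE unlift_none. Qed.

Section Extension.
Variables (k : nat) (phi : bcochain R B k).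
Hypothesis phiF : is_bform phi.

(** By injectivity of [bjoin] the sum has at most one term; it avoids choosing a preimage. *)
Definition extend_by0 (v : vtuple T k.+1) : R := \sum_(p | bjoin p == v) phi p.

(* Moves the unique vertex of [v] lying in [B], if any, to the first place. *)
Definition extension : cochain R T k :=
  [ffun v : vtuple T k.+1 => \sum_(j < k.+1) (-1) ^+ j * extend_by0 (vcons (v j) (vdrop j v))].

Lemma extend_by0_perm x (t : 'S_k) (u : vtuple T k) :
  extend_by0 (vcons x (vperm t u)) = (-1) ^+ t * extend_by0 (vcons x u).
Proof.
have [phis _] := phiF.
pose h (s : 'S_k) (p : bvert B * vtuple (ivert B) k) := (p.1, vperm s p.2).
have hK (s : 'S_k) : cancel (h s) (h s^-1%g) by case=> b v; rewrite /h /= vpermK.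
rewrite /extend_by0 (reindex_inj (can_inj (hK t))) mulr_sumr /=.
apply: eq_big => [[b v]|[b v] _]; last exact: phis.
have bE (s : 'S_k) : bjoin (h s (b, v)) = vperm (lift_perm ord0 ord0 s) (bjoin (b, v)).
  apply/ffunP => i; rewrite !ffunE; case: (unliftP ord0 i) => [j ->|->].
    by rewrite lift_perm_lift liftK !ffunE.
  by rewrite lift_perm_id unlift_none.
have -> : vcons x (vperm t u) = vperm (lift_perm ord0 ord0 t) (vcons x u).
  apply/ffunP => i; rewrite !ffunE; case: (unliftP ord0 i) => [j ->|->].
    by rewrite lift_perm_lift liftK !ffunE.
  by rewrite lift_perm_id unlift_none.
by rewrite bE (can_eq (vpermK _)).
Qed.

Lemma vset_cons_drop (v : vtuple T k.+1) j : vset (vcons (v j) (vdrop j v)) = vset v.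
Proof.
rewrite -(vset_perm (lift_perm ord0 j 1) v); congr vset.
apply/ffunP => i; rewrite !ffunE; case: (unliftP ord0 i) => [u ->|->].
  by rewrite lift_perm_lift ffunE perm1.
by rewrite lift_perm_id.
Qed.

(** [s] carries the term at [j] to the term at [s j], up to the permutation [t] induced on the
    remaining entries; the parities of [j], [s j] and [t] combine to that of [s]. Off cliques every
    term vanishes, because moving an entry to the front keeps the vertex set. *)
Lemma extension_form : is_form G extension.
Proof.
have [_ phi0] := phiF; split=> [s v|v vG]; rewrite !ffunE.
  rewrite mulr_sumr [RHS](reindex_inj (@perm_inj _ s)) /=.
  apply: eq_bigr => j _; have [t sE sgn] := ord_perm_lift s j.
  have -> : vdrop j (vperm s v) = vperm t (vdrop (s j) v).
    by apply/ffunP=> i; rewrite !ffunE {1}sE lift_perm_lift.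
  rewrite ffunE extend_by0_perm !mulrA -(signr_odd _ j) -(signr_odd _ (s j)).
  by rewrite -!signr_addb sgn addbAC addbK.
rewrite big1 // => j _; rewrite /extend_by0 big1 ?mulr0 // => p /eqP pE.
apply: phi0; rewrite pE vset_cons_drop; apply: contraNN vG.
by rewrite inE => /andP [].
Qed.

Lemma extension_restrict : restrict B extension = phi.
Proof.
apply/ffunP => p; rewrite !ffunE (bigD1 ord0) //= big1 ?addr0 => [|j].
  have -> : vcons (bjoin p ord0) (vdrop ord0 (bjoin p)) = bjoin p.
    apply/ffunP => i; rewrite ffunE; case: (unliftP ord0 i) => [u ->|->] //.
    by rewrite ffunE.
  rewrite mul1r /extend_by0 (bigD1 p) //= big1 ?addr0 // => q /andP [/eqP /bjoin_inj ->].
  by rewrite eqxx.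
(* For [j] other than 0 the entry moved to the front is interior, whereas every [bjoin q] starts in
   [B]. *)
case: (unliftP ord0 j) => [i ->|->] // _.
rewrite /extend_by0 big1 ?mulr0 // => q /eqP /ffunP /(_ ord0).
rewrite !ffunE !unlift_none liftK ffunE => e.
by have := valP (p.2 i); rewrite /= -e (valP q.1).
Qed.

End Extension.

(** * Critical points with prescribed boundary data *)

Lemma dirichlet_problem k (Q : space k -> space k -> R) (phi : bcochain R B k) :
  psd_form Q -> is_bform phi ->
  exists omega : cochain R T k, [/\ is_form G omega, restrict B omega = phi &
    forall v, vset v \in cliques G k.+1 -> vset v \subset ~: (B : {set T}) ->
      Q omega (skew_delta v) = 0].
Proof.
move=> Qpsd phiF.
pose good (v : vtuple T k.+1) :=
  (vset v \in cliques G k.+1) && (vset v \subset ~: (B : {set T})).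
pose us : seq (space k) := [seq skew_delta v | v <- enum good].
pose admissible (f : cochain R T k) :=
  is_form G f /\ forall p : bvert B * vtuple (ivert B) k, f (bjoin p) = 0.
(* The correction [a] is a combination of deltas at interior cliques, and the corrected extension is
   [Q]-orthogonal to all of them. *)
have [a aU aP] := psd_projection Qpsd us (extension phi).
have usP u : u \in us -> admissible u.
  case/mapP => v; rewrite mem_enum => /andP [vG /subsetP vB] ->.
  split=> [|p]; first exact: skew_delta_form.
  apply: skew_delta_eq0; apply/eqP => e.
  have /vB : val p.1 \in vset v by rewrite -e; exact: vset_bjoin.
  by rewrite inE (valP p.1).
(* Admissibility is stable under linear combinations, hence passes from the generators to their
   span. *)
have [aF a0] : admissible a.
  elim: us usP a aU {aP} => [|u us IH] usP a.
    rewrite span_nil memv0 => /eqP ->.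
    by split=> [|p]; [split=> *|]; rewrite !ffunE ?mulr0.
  rewrite span_cons => /memv_addP [_ /vlineP [c ->]] [y yus ->].
  have [uF u0] := usP u (mem_head _ _).
  have [|yF y0] := IH _ y yus; first by move=> i iu; apply: usP; rewrite inE iu orbT.
  split=> [|p]; first exact: is_form_linear.
  by rewrite scale_addE u0 y0 mulr0 addr0.
(* The factor 1 gives the sum the shape expected by [is_form_linear]. *)
exists (1 *: (extension phi : space k) + a); split=> [||v vG vB].
- exact: is_form_linear (extension_form phiF) aF.
- apply/ffunP => p; rewrite -[in RHS](extension_restrict phi) ffunE scale_addE.
  by rewrite a0 mul1r addr0 [RHS]ffunE.
rewrite scale1r aP // memv_span // map_f // mem_enum.
by rewrite unfold_in /good vG.
Qed.

(** * Pointwise equations from energies tested on deltas *)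

Lemma codiff_d_skew_delta k (f : cochain R T k) v :
  is_form G f -> vset v \in cliques G k.+1 ->
  codiff_d w f v * w k v = inner w (dext G f) (dext G (skew_delta v)).
Proof.
move=> fF vG; have [gF gA] := codiffP w (dext_form fF).
rewrite [RHS]inner_sym (gA _ (skew_delta_form vG)) inner_sym.
by rewrite (inner_skew_delta v gF).
Qed.

(** Here the delta takes the codifferential: adjointness is applied with [skew_delta v] as the form
    of higher degree. *)
Lemma d_codiff_skew_delta k (f : cochain R T k.+1) v :
  is_form G f -> vset v \in cliques G k.+2 ->
  d_codiff w f v * w k.+1 v =
  inner w (codiff_formula w f) (codiff_formula w (skew_delta v)).
Proof.
move=> fF vG; have gF := codiff_formula_form w fF.
have [_ gA] := codiff_formula_adjoint w (skew_delta_form vG).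
rewrite -(gA _ gF) /= (codiffE fF).
by rewrite (inner_skew_delta v (dext_form gF)).
Qed.

Lemma wgt_cancel k v (x : R) :
  vset v \in cliques G k.+1 -> x * w k v = 0 -> x = 0.
Proof.
move=> vG /eqP; rewrite mulf_eq0 (gt_eqF (wgt_gt0 w vG)) orbF.
by move/eqP.
Qed.

End Forms.

Theorem theorem3p1 (R : realType) (T : finType) (G : graph T)
    (B : boundary G) (w : weight R G) (k : nat)
    (phi : bcochain R B k) (phiF : is_bform phi) :
  (exists omega : cochain R T k,
     [/\ is_form G omega,
         zero_in_interior B (codiff_d w omega)
       & restrict B omega = phi]) /\
  (exists omega : cochain R T k,
     [/\ is_form G omega,
         zero_in_interior B (d_codiff w omega)
       & restrict B omega = phi]) /\
  (exists omega : cochain R T k,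
     [/\ is_form G omega,
         zero_in_interior B (laplacian w omega)
       & restrict B omega = phi]).
Proof.
have dP l := psd_form_comp w (@dext_linear R T G l).
have deltaP l := psd_form_comp w (@codiff_formula_linear R T G w l).
have sol_i : exists omega : cochain R T k,
    [/\ is_form G omega, zero_in_interior B (codiff_d w omega)
      & restrict B omega = phi].
  have [om [omF omB om0]] := dirichlet_problem (dP k) phiF.
  exists om; split=> // v vG vB; apply: (wgt_cancel (w := w) vG).
  by rewrite codiff_d_skew_delta // om0.
(* In degree 0 [d_codiff] is 0 by definition, so a solution of (i) also solves (ii) and (iii). *)
split=> //; case: k phi phiF sol_i => [|k] phi phiF sol_i.
  split; last first.
    by have [om [? om0 ?]] := sol_i; exists om; split=> //; rewrite /laplacian /= add0r.
  by have [om [? _ ?]] := sol_i; exists om; split=> // v _ _; rewrite /= ffunE.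
split.
  have [om [omF omB om0]] := dirichlet_problem (deltaP k) phiF.
  exists om; split=> // v vG vB; apply: (wgt_cancel (w := w) vG).
  by rewrite d_codiff_skew_delta // om0.
(* The sum of the two energies pairs [om] with a delta to give the weighted value of the
   Laplacian. *)
have [om [omF omB om0]] := dirichlet_problem (psd_formD (deltaP k) (dP k.+1)) phiF.
exists om; split=> // v vG vB; apply: (wgt_cancel (w := w) vG).
by rewrite ffunE mulrDl d_codiff_skew_delta // codiff_d_skew_delta // om0.
Qed.
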